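(* For any formulas $\phi$ and $\psi$ in the language of $\mathbf{PT}^+$: if $\psi\models\phi$ then $\psi\vdash\phi$ in the natural deduction system of $\mathbf{PT}^+$. In particular, if $\models\phi$ then $\vdash\phi$.
   Context: Formulas of $\mathbf{PT}^+$: $\phi::=p_i\mid\neg p_i\mid\bot\mid\mathrm{NE}\mid\phi\wedge\phi\mid\phi\otimes\phi\mid\phi\vee\phi$ ($i\in\mathbb N$). A valuation is $s:\mathbb N\to\{0,1\}$, a team a set of valuations. Semantics: $X\models p_i$ iff $s(i)=1$ for all $s\in X$; $X\models\neg p_i$ iff $s(i)=0$ for all $s\in X$; $X\models\bot$ iff $X=\emptyset$; $X\models\mathrm{NE}$ iff $X\ne\emptyset$; $\wedge$ as usual; $X\models\phi\otimes\psi$ iff $X=Y\cup Z$ for some $Y,Z\subseteq X$ with $Y\models\phi$, $Z\models\psi$; $X\models\phi\vee\psi$ iff $X\models\phi$ or $X\models\psi$. $\psi\models\phi$: every team satisfying $\psi$ satisfies $\phi$; $\models\phi$: every team satisfies $\phi$. Classical formulas: built from $p_i,\neg p_i,\bot$ by $\wedge,\otimes$. $p_i^1=p_i$, $p_i^0=\neg p_i$; empty $\otimes$-disjunction is $\bot$, empty $\vee$-disjunction is $\bot\wedge\mathrm{NE}$; for a team $X$ on finite $\{i_1,\dots,i_n\}$, $\Theta^*_X=\bigotimes_{s\in X}(p_{i_1}^{s(i_1)}\wedge\dots\wedge p_{i_n}^{s(i_n)}\wedge\mathrm{NE})$. Natural deduction system of $\mathbf{PT}^+$ ($\Gamma\vdash\phi$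 iff some derivation of $\phi$ has undischarged assumptions in $\Gamma$; metavariables range over all formulas, axioms are the specific formulas shown, no substitution rule). Axioms: $p_i\otimes\neg p_i$ (each $i$); $\bot\vee\mathrm{NE}$. Rules: standard $\wedge$-introduction/elimination; $\vee$-introduction (from $\phi$ infer $\phi\vee\psi$ and $\psi\vee\phi$) and $\vee$-elimination (from $\phi\vee\psi$, a derivation of $\chi$ from $\phi$ and one from $\psi$, infer $\chi$, discharging $\phi,\psi$); from $\phi$ infer $\phi\otimes\psi$ provided $\psi$ does not contain $\mathrm{NE}$; from $\phi$ infer $\phi\otimes\phi$; from $\phi\otimes\psi$, a derivation of $\alpha$ from $\phi$ and one of $\alpha$ from $\psi$, infer $\alpha$ (discharging $\phi,\psi$), provided $\alpha$ is classical and the other undischarged assumptions of both subderivations are classical; from $\phi\otimes\psi$ and a derivation of $\chi$ from $\psi$ (discharged) infer $\phi\otimes\chi$, provided the other undischarged assumptions of that subderivation are classical; from $\phi\otimes\psi$ infer $\psi\otimes\phi$; from $\phi\otimes(\psi\otimes\chi)$ infer $(\phi\otimes\psi)\otimes\chi$; from $p_i\wedge\neg p_i$ infer $\bot$; from $\phi\otimes\bot$ infer $\phi$; from $\bot\wedge\mathrm{NE}$ infer any $\phi$; from $\phi\otimes(\bot\wedge\mathrm{NE})$ infer $\bot\wedge\mathrm{NE}$; from $\Theta^*_X\wedge\Theta^*_Y$ infer $\bot\wedge\mathrm{NE}$ whenever $X,Y$ are distinct teams on the same finite index set; from $\phi\otimes(\psi\vee\chi)$ infer $(\phi\otimes\psi)\vee(\phi\otimes\chi)$;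 from $\mathrm{NE}\wedge\bigotimes_{i\in I}\phi_i$ ($I$ finite) infer $\bigvee_{\emptyset\ne J\subseteq I}\bigotimes_{i\in J}(\mathrm{NE}\wedge\phi_i)$. *)

(* Defs.v *)
From mathcomp Require Import all_boot finmap classical_sets.

Set Implicit Arguments.
Unset Strict Implicit.
Unset Printing Implicit Defensive.

Local Open Scope classical_set_scope.

Inductive form : Type :=
| Var of nat
| NegVar of nat
| Bot
| NE
| And of form & form
| Tens of form & form
| Or of form & form.

Definition valuation := nat -> bool.
Definition team := set valuation.

Fixpoint sat (X : team) (phi : form) : Prop :=
  match phi with
  | Var i => forall s, X s -> s i = true
  | NegVar i => forall s, X s -> s i = false
  | Bot => X = set0
  | NE => X <> set0
  | And phi psi => sat X phi /\ sat X psi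
  | Tens phi psi => exists Y Z : team,
      [/\ Y `<=` X, Z `<=` X, X = Y `|` Z, sat Y phi & sat Z psi]
  | Or phi psi => sat X phi \/ sat X psi
  end.

Definition entails (psi phi : form) : Prop :=
  forall X : team, sat X psi -> sat X phi.

Definition valid (phi : form) : Prop := forall X : team, sat X phi.

Fixpoint classical (phi : form) : bool :=
  match phi with
  | Var _ | NegVar _ | Bot => true
  | NE | Or _ _ => false
  | And phi psi | Tens phi psi => classical phi && classical psi
  end.

Fixpoint NE_free (phi : form) : bool :=
  match phi with
  | NE => false
  | Var _ | NegVar _ | Bot => true
  | And phi psi | Tens phi psi | Or phi psi => NE_free phi && NE_free psi
  end.

Definition BotNE : form := And Bot NE.

(* Iterated connectives are nested to the right; the unit appears only for
   the empty sequence. *)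
Fixpoint bigTens (l : seq form) : form :=
  match l with
  | [::] => Bot
  | [:: phi] => phi
  | phi :: l' => Tens phi (bigTens l')
  end.

Fixpoint bigOr (l : seq form) : form :=
  match l with
  | [::] => BotNE
  | [:: phi] => phi
  | phi :: l' => Or phi (bigOr l')
  end.

Definition lit (i : nat) (b : bool) : form := if b then Var i else NegVar i.

Definition conjNE (N : {fset nat}) (s : {ffun N -> bool}) : form :=
  foldr And NE [seq lit (val i) (s i) | i : N].

(* A team on the finite index set N is a set of functions from N to {0,1}. *)
Definition Theta (N : {fset nat}) (X : {set {ffun N -> bool}}) : form :=
  bigTens [seq conjNE s | s <- enum X].

(* deriv A phi: there is a derivation of phi whose set of undischarged
   assumptions is exactly A.  Discharging phi removes it from that set. *)
Inductive deriv : set form -> form -> Prop :=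
| D_assume phi :
    deriv [set phi] phi
| D_exclmid i :
    deriv set0 (Tens (Var i) (NegVar i))
| D_BotorNE :
    deriv set0 (Or Bot NE)
| D_andI A B phi psi :
    deriv A phi -> deriv B psi -> deriv (A `|` B) (And phi psi)
| D_andEl A phi psi :
    deriv A (And phi psi) -> deriv A phi
| D_andEr A phi psi :
    deriv A (And phi psi) -> deriv A psi
| D_orIl A phi psi :
    deriv A phi -> deriv A (Or phi psi)
| D_orIr A phi psi :
    deriv A phi -> deriv A (Or psi phi)
| D_orE A B C phi psi chi :
    deriv A (Or phi psi) -> deriv B chi -> deriv C chi ->
    deriv (A `|` (B `\ phi) `|` (C `\ psi)) chi
| D_tensI A phi psi :
    NE_free psi -> deriv A phi -> deriv A (Tens phi psi)
| D_tensdup A phi :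
    deriv A phi -> deriv A (Tens phi phi)
| D_tensE A B C phi psi alpha :
    classical alpha ->
    (forall beta, (B `\ phi) beta -> classical beta) ->
    (forall beta, (C `\ psi) beta -> classical beta) ->
    deriv A (Tens phi psi) -> deriv B alpha -> deriv C alpha ->
    deriv (A `|` (B `\ phi) `|` (C `\ psi)) alpha
| D_tenssub A B phi psi chi :
    (forall beta, (B `\ psi) beta -> classical beta) ->
    deriv A (Tens phi psi) -> deriv B chi ->
    deriv (A `|` (B `\ psi)) (Tens phi chi)
| D_tensC A phi psi :
    deriv A (Tens phi psi) -> deriv A (Tens psi phi)
| D_tensA A phi psi chi :
    deriv A (Tens phi (Tens psi chi)) -> deriv A (Tens (Tens phi psi) chi)
| D_contra A i :
    deriv A (And (Var i) (NegVar i)) -> deriv A Bot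
| D_tensBot A phi :
    deriv A (Tens phi Bot) -> deriv A phi
| D_exfalso A phi :
    deriv A BotNE -> deriv A phi
| D_tensBotNE A phi :
    deriv A (Tens phi BotNE) -> deriv A BotNE
| D_Theta A (N : {fset nat}) (X Y : {set {ffun N -> bool}}) :
    X <> Y -> deriv A (And (Theta X) (Theta Y)) -> deriv A BotNE
| D_tensOr A phi psi chi :
    deriv A (Tens phi (Or psi chi)) ->
    deriv A (Or (Tens phi psi) (Tens phi chi))
| D_NEtens A (I : finType) (phi : I -> form) :
    deriv A (And NE (bigTens [seq phi i | i : I])) ->
    deriv A (bigOr [seq bigTens [seq And NE (phi i) | i in J]
                   | J : {set I} in [pred J : {set I} | J != finset.set0]]).

Definition derivable (Gamma : set form) (phi : form) : Prop :=
  exists A : set form, A `<=` Gamma /\ deriv A phi.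

(* Main.v *)
(** Fix a finite index set [N] containing the variables at hand.  Every team on
    [N] is described by exactly one of the formulas [Theta X], and their
    disjunction is provable: excluded middle gives the tensor of all complete
    conjunctions of literals, and the NE-distribution rule then selects the
    nonempty ones.  Hence every formula is interderivable with the disjunction
    of the [Theta X] over the [X] satisfying it.  Both directions are inductions
    on the formula in which the tensor is handled by reading [Theta] as a sum
    over a set, since complete conjunctions with NE are tensor-idempotent.  On
    such normal forms an entailment is an inclusion of sets of disjuncts. *)

Require Import Defs.
From mathcomp Require Import all_boot finmap boolp classical_sets.
From Stdlib Require Import Morphisms.

Set Implicit Arguments.
Unset Strict Implicit.
Unset Printing Implicit Defensive.

Local Open Scope classical_set_scope.

Definition classical_ctx (G : set form) : Prop :=
  forall beta, G beta -> classical beta.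

Definition proves (phi psi : form) : Prop := derivable [set phi] psi.

Definition interderivable (phi psi : form) : Prop :=
  proves phi psi /\ proves psi phi.

Definition Top : form := Tens (Var 0) (NegVar 0).

Fixpoint vars (phi : form) : {fset nat} :=
  match phi with
  | Var i | NegVar i => [fset i]%fset
  | Bot | NE => fset0
  | And psi chi | Tens psi chi | Or psi chi => (vars psi `|` vars chi)%fset
  end.

(** * Derived rules *)

Section DerivedRules.
Implicit Types (A B G D : set form) (phi psi chi alpha : form).

Lemma derivable_weak G D phi : G `<=` D -> derivable G phi -> derivable D phi.
Proof.
by move=> GD [A [AG dA]]; exists A; split=> //; exact: subset_trans GD.
Qed.

Lemma derivable_weakU1 G phi psi : derivable G psi -> derivable (phi |` G) psi.
Proof. by apply: derivable_weak; exact: subsetUr. Qed.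

Lemma derivable_assume G phi : G phi -> derivable G phi.
Proof.
by move=> Gphi; exists [set phi]; split; [move=> _ -> | exact: D_assume].
Qed.

Lemma derivable_setU1 G phi : derivable (phi |` G) phi.
Proof. by apply: derivable_assume; left. Qed.

Lemma derivable_axiom G phi : deriv set0 phi -> derivable G phi.
Proof. by move=> dphi; exists set0; split. Qed.

Lemma derivable_Top G : derivable G Top.
Proof. exact/derivable_axiom/D_exclmid. Qed.

Lemma derivable_andI G phi psi :
  derivable G phi -> derivable G psi -> derivable G (And phi psi).
Proof.
move=> [A [AG dA]] [B [BG dB]]; exists (A `|` B); split; last exact: D_andI.
by rewrite subUset.
Qed.

Lemma derivable_unary_rule G phi psi :
  (forall A, deriv A phi -> deriv A psi) -> derivable G phi -> derivable G psi.
Proof. by move=> rule [A [AG dA]]; exists A; split=> //; exact: rule. Qed.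

Lemma derivable_andEl G phi psi : derivable G (And phi psi) -> derivable G phi.
Proof. by apply: derivable_unary_rule => A; exact: D_andEl. Qed.

Lemma derivable_andEr G phi psi : derivable G (And phi psi) -> derivable G psi.
Proof. by apply: derivable_unary_rule => A; exact: D_andEr. Qed.

Lemma derivable_orIl G phi psi : derivable G phi -> derivable G (Or phi psi).
Proof. by apply: derivable_unary_rule => A; exact: D_orIl. Qed.

Lemma derivable_orIr G phi psi : derivable G psi -> derivable G (Or phi psi).
Proof. by apply: derivable_unary_rule => A; exact: D_orIr. Qed.

Lemma derivable_tensI G phi psi :
  NE_free psi -> derivable G phi -> derivable G (Tens phi psi).
Proof. by move=> ?; apply: derivable_unary_rule => A; exact: D_tensI. Qed.

Lemma derivable_tensdup G phi : derivable G phi -> derivable G (Tens phi phi).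
Proof. by apply: derivable_unary_rule => A; exact: D_tensdup. Qed.

Lemma derivable_tensC G phi psi :
  derivable G (Tens phi psi) -> derivable G (Tens psi phi).
Proof. by apply: derivable_unary_rule => A; exact: D_tensC. Qed.

Lemma derivable_tensA G phi psi chi :
  derivable G (Tens phi (Tens psi chi)) ->
  derivable G (Tens (Tens phi psi) chi).
Proof. by apply: derivable_unary_rule => A; exact: D_tensA. Qed.

Lemma derivable_tensBot G phi : derivable G (Tens phi Bot) -> derivable G phi.
Proof. by apply: derivable_unary_rule => A; exact: D_tensBot. Qed.

Lemma derivable_tensBotNE G phi :
  derivable G (Tens phi BotNE) -> derivable G BotNE.
Proof. by apply: derivable_unary_rule => A; exact: D_tensBotNE. Qed.

Lemma derivable_tens_or G phi psi chi :
  derivable G (Tens phi (Or psi chi)) ->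
  derivable G (Or (Tens phi psi) (Tens phi chi)).
Proof. by apply: derivable_unary_rule => A; exact: D_tensOr. Qed.

Lemma derivable_exfalso G phi : derivable G BotNE -> derivable G phi.
Proof. by apply: derivable_unary_rule => A; exact: D_exfalso. Qed.

Lemma derivable_lit_contra G i b c :
  b != c -> derivable G (lit i b) -> derivable G (lit i c) -> derivable G Bot.
Proof.
have contra : derivable G (Var i) -> derivable G (NegVar i) -> derivable G Bot.
  move=> dVar /(derivable_andI dVar).
  by apply: derivable_unary_rule => A; exact: D_contra.
by case: b c => [] [] //= _ dlit_b dlit_c; exact: contra.
Qed.

Lemma derivable_Theta_contra G (N : {fset nat}) (X Y : {set {ffun N -> bool}}) :
  X <> Y -> derivable G (Theta X) -> derivable G (Theta Y) ->
  derivable G BotNE.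
Proof.
move=> XY dX dY; apply: derivable_unary_rule (derivable_andI dX dY) => A.
exact: D_Theta.
Qed.

Lemma derivable_NE_bigTens G (I : finType) (c : I -> form) :
  derivable G NE -> derivable G (bigTens [seq c i | i : I]) ->
  derivable G (bigOr [seq bigTens [seq And NE (c i) | i in J]
                     | J : {set I} in [pred J : {set I} | J != finset.set0]]).
Proof.
move=> dNE dc; apply: derivable_unary_rule (derivable_andI dNE dc) => A.
exact: D_NEtens.
Qed.

Lemma discharge_subset A G phi : A `<=` phi |` G -> A `\ phi `<=` G.
Proof. by move=> AG x [/AG[]]. Qed.

Lemma derivable_orE G phi psi chi :
  derivable G (Or phi psi) ->
  derivable (phi |` G) chi -> derivable (psi |` G) chi -> derivable G chi.
Proof.
move=> [A [AG dA]] [B [/discharge_subset BG dB]] [C [/discharge_subset CG dC]].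
exists (A `|` (B `\ phi) `|` (C `\ psi)); split; last exact: D_orE dA dB dC.
by rewrite !subUset.
Qed.

(* The system has no cut rule; a detour through a disjunction simulates it. *)
Lemma derivable_cut G phi psi :
  derivable G phi -> derivable (phi |` G) psi -> derivable G psi.
Proof.
by move=> dphi dpsi; apply: derivable_orE (derivable_orIl phi dphi) _ _.
Qed.

Lemma derivable_Bot_NE_cases G chi :
  derivable (Bot |` G) chi -> derivable (NE |` G) chi -> derivable G chi.
Proof. by apply: derivable_orE; exact/derivable_axiom/D_BotorNE. Qed.

Lemma derivable_tensE G D phi psi alpha :
  classical alpha -> classical_ctx D -> D `<=` G ->
  derivable G (Tens phi psi) ->
  derivable (phi |` D) alpha -> derivable (psi |` D) alpha ->
  derivable G alpha.
Proof.
move=> alpha_cl D_cl DG [A [AG dA]].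
move=> [B [/discharge_subset BD dB]] [C [/discharge_subset CD dC]].
exists (A `|` (B `\ phi) `|` (C `\ psi)); split.
  by rewrite !subUset; split; [split|] => //; exact: subset_trans DG.
by apply: D_tensE dA dB dC => // beta; [move/BD|move/CD] => /D_cl.
Qed.

Lemma derivable_tens_sub G D phi psi chi :
  classical_ctx D -> D `<=` G ->
  derivable G (Tens phi psi) -> derivable (psi |` D) chi ->
  derivable G (Tens phi chi).
Proof.
move=> D_cl DG [A [AG dA]] [B [/discharge_subset BD dB]].
exists (A `|` (B `\ psi)); split.
  by rewrite subUset; split=> //; exact: subset_trans DG.
by apply: D_tenssub dA dB => beta /BD/D_cl.
Qed.

Lemma derivable_tens_absurd G D phi psi :
  classical_ctx D -> D `<=` G ->
  derivable G (Tens phi psi) -> derivable (psi |` D) BotNE ->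
  derivable G BotNE.
Proof.
move=> D_cl DG dtens /(derivable_tens_sub D_cl DG dtens).
exact: derivable_tensBotNE.
Qed.

End DerivedRules.

(** * Derivability between formulas *)

Section Proves.
Implicit Types (G : set form) (phi psi chi alpha : form).

Lemma proves_refl phi : proves phi phi.
Proof. exact: derivable_assume. Qed.

Lemma derivable_proves G phi psi :
  proves phi psi -> derivable G phi -> derivable G psi.
Proof.
move=> phi_psi dphi; apply: derivable_cut dphi _.
by apply: derivable_weak phi_psi; exact: subsetUl.
Qed.

Lemma derivable_setU1_proves G phi psi :
  proves phi psi -> derivable (phi |` G) psi.
Proof. by move/derivable_proves; apply; exact: derivable_setU1. Qed.

Lemma proves_trans phi psi chi :
  proves phi psi -> proves psi chi -> proves phi chi.
Proof. by move=> phi_psi /derivable_proves; exact. Qed.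

Lemma proves_tensr phi psi psi' :
  proves psi psi' -> proves (Tens phi psi) (Tens phi psi').
Proof.
move=> psi_psi'; apply: (@derivable_tens_sub _ set0 phi psi) => //.
  exact: proves_refl.
exact: derivable_setU1_proves.
Qed.

Lemma proves_tensl phi phi' psi :
  proves phi phi' -> proves (Tens phi psi) (Tens phi' psi).
Proof.
move=> /(proves_tensr psi)/derivable_proves-tens_psi; apply: derivable_tensC.
apply: tens_psi; exact/derivable_tensC/proves_refl.
Qed.

Lemma proves_tens phi phi' psi psi' :
  proves phi phi' -> proves psi psi' -> proves (Tens phi psi) (Tens phi' psi').
Proof.
move=> phi_phi' psi_psi'; apply: proves_trans (proves_tensl psi phi_phi') _.
exact: proves_tensr.
Qed.

Lemma tens_proves phi psi alpha : classical alpha ->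
  proves phi alpha -> proves psi alpha -> proves (Tens phi psi) alpha.
Proof.
move=> alpha_cl phi_alpha psi_alpha.
apply: (@derivable_tensE _ set0 phi psi) => //.
- exact: proves_refl.
- exact: derivable_setU1_proves.
- exact: derivable_setU1_proves.
Qed.

Lemma Bot_proves phi : NE_free phi -> proves Bot phi.
Proof.
move=> phi_NEfree; apply/derivable_tensBot/derivable_tensC.
exact: derivable_tensI (proves_refl Bot).
Qed.

(* [Bot] is classical, so it may be used inside a tensor component. *)
Lemma tens_proves_NE phi psi : proves phi NE -> proves (Tens phi psi) NE.
Proof.
move=> phi_NE; apply: derivable_Bot_NE_cases; last exact: derivable_setU1.
apply: derivable_exfalso; apply: (@derivable_tens_absurd _ [set Bot] psi phi).
- by move=> _ ->.
- exact: subsetUl.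
- exact/derivable_weakU1/derivable_tensC/proves_refl.
- apply: derivable_andI; first exact/derivable_weakU1/proves_refl.
  exact: derivable_setU1_proves.
Qed.

Lemma interderivable_tensC phi psi :
  interderivable (Tens phi psi) (Tens psi phi).
Proof. by split; exact/derivable_tensC/proves_refl. Qed.

Lemma interderivable_tens_Bot phi : interderivable (Tens phi Bot) phi.
Proof.
split; first exact/derivable_tensBot/proves_refl.
exact: derivable_tensI (proves_refl phi).
Qed.

End Proves.

#[local] Hint Resolve proves_refl : core.

#[local] Instance interderivable_equivalence : Equivalence interderivable.
Proof.
split=> [phi|phi psi []//|phi psi chi [phi_psi psi_phi] [psi_chi chi_psi]].
  by split.
by split; [exact: proves_trans psi_chi | exact: proves_trans psi_phi].
Qed.

#[local] Instance Tens_interderivable :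
  Proper (interderivable ==> interderivable ==> interderivable) Tens.
Proof. by move=> ? ? [? ?] ? ? [? ?]; split; exact: proves_tens. Qed.

#[local] Instance derivable_interderivable (G : set form) :
  Proper (interderivable ==> iff) (derivable G).
Proof. by move=> phi psi []; split; exact: derivable_proves. Qed.

#[local] Instance proves_interderivable :
  Proper (interderivable ==> interderivable ==> iff) proves.
Proof.
move=> phi phi' [phi_phi' phi'_phi] psi psi' [psi_psi' psi'_psi].
split=> [phi_psi|phi'_psi'].
  exact: proves_trans phi'_phi (proves_trans phi_psi psi_psi').
exact: proves_trans phi_phi' (proves_trans phi'_psi' psi'_psi).
Qed.

Lemma interderivable_tensA phi psi chi :
  interderivable (Tens phi (Tens psi chi)) (Tens (Tens phi psi) chi).
Proof.
split; first exact/derivable_tensA/proves_refl.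
rewrite (interderivable_tensC (Tens phi psi)) (interderivable_tensC phi psi).
rewrite (interderivable_tensC phi) (interderivable_tensC psi chi).
exact/derivable_tensA/proves_refl.
Qed.

(** * Iterated connectives *)

Lemma bigTens_cons phi (s : seq form) :
  interderivable (bigTens (phi :: s)) (Tens phi (bigTens s)).
Proof. by case: s => [|psi s] //=; rewrite interderivable_tens_Bot. Qed.

Lemma bigTens_cat (s t : seq form) :
  interderivable (bigTens (s ++ t)) (Tens (bigTens s) (bigTens t)).
Proof.
elim: s => [|phi s IHs]; last first.
  by rewrite cat_cons !bigTens_cons IHs interderivable_tensA.
by rewrite interderivable_tensC interderivable_tens_Bot.
Qed.

Section IteratedConnectives.
Variables (T : eqType) (c : T -> form).
Implicit Types (x y : T) (l m : seq T).
Implicit Types (G : set form) (phi chi alpha : form).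

Lemma NE_free_bigTens l :
  (forall x, NE_free (c x)) -> NE_free (bigTens (map c l)).
Proof.
by move=> c_NEfree; elim: l => [|x [|y l] IHl] //=; rewrite c_NEfree.
Qed.

Lemma classical_bigTens l :
  (forall x, classical (c x)) -> classical (bigTens (map c l)).
Proof. by move=> c_cl; elim: l => [|x [|y l] IHl] //=; rewrite c_cl. Qed.

Lemma proves_bigTensI x l :
  (forall y, NE_free (c y)) -> x \in l -> proves (c x) (bigTens (map c l)).
Proof.
move=> c_NEfree; elim: l => // y l IHl.
rewrite inE map_cons bigTens_cons => /predU1P[<-|/IHl x_l].
  by apply: derivable_tensI (proves_refl _); exact: NE_free_bigTens.
exact/derivable_tensC/derivable_tensI.
Qed.

Lemma bigTens_proves alpha l :
  classical alpha -> NE_free alpha ->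
  (forall x, x \in l -> proves (c x) alpha) ->
  proves (bigTens (map c l)) alpha.
Proof.
move=> alpha_cl alpha_NEfree; elim: l => [|x l IHl] c_alpha.
  exact: Bot_proves.
rewrite map_cons bigTens_cons; apply: tens_proves => //.
  by apply: c_alpha; exact: mem_head.
by apply: IHl => y yl; apply: c_alpha; rewrite inE yl orbT.
Qed.

Lemma proves_bigTens (d : T -> form) l : (forall x, proves (c x) (d x)) ->
  proves (bigTens (map c l)) (bigTens (map d l)).
Proof.
move=> c_d; elim: l => [|x l IHl] //.
by rewrite !map_cons !bigTens_cons; exact: proves_tens.
Qed.

Lemma proves_bigOrI x l : x \in l -> proves (c x) (bigOr (map c l)).
Proof.
elim: l => // y [|z l] IHl; first by rewrite inE => /eqP->.
rewrite inE => /predU1P[<-|/IHl]; last exact: derivable_orIr.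
exact/derivable_orIl/proves_refl.
Qed.

Lemma derivable_bigOrE G chi l : derivable G (bigOr (map c l)) ->
  (forall x, x \in l -> derivable (c x |` G) chi) -> derivable G chi.
Proof.
elim: l G => [|y [|z l] IHl] G /= dOr c_chi.
- exact: derivable_exfalso.
- by apply: derivable_cut dOr _; apply: c_chi; rewrite inE.
apply: derivable_orE dOr _ _; first by apply: c_chi; exact: mem_head.
apply: IHl => [|x xl]; first exact: derivable_setU1.
apply: derivable_weak (c_chi x _); last by rewrite inE xl orbT.
exact/setUS/subsetUr.
Qed.

Lemma bigOr_subset_proves l m :
  {subset l <= m} -> proves (bigOr (map c l)) (bigOr (map c m)).
Proof.
move=> lm; apply: derivable_bigOrE (proves_refl _) _ => x /lm xm.
exact/derivable_setU1_proves/proves_bigOrI.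
Qed.

Lemma tens_bigOr_proves phi chi l :
  (forall x, x \in l -> proves (Tens phi (c x)) chi) ->
  proves (Tens phi (bigOr (map c l))) chi.
Proof.
elim: l => [|y [|z l] IHl] tens_chi.
- exact/derivable_exfalso/derivable_tensBotNE/proves_refl.
- by apply: tens_chi; rewrite inE.
apply: derivable_orE (derivable_tens_or (proves_refl _)) _ _;
  apply: derivable_setU1_proves; first by apply: tens_chi; exact: mem_head.
by apply: IHl => x xl; apply: tens_chi; rewrite inE xl orbT.
Qed.

Lemma derivable_foldr_AndP G phi l :
  derivable G (foldr And phi (map c l)) <->
  derivable G phi /\ (forall x, x \in l -> derivable G (c x)).
Proof.
split=> [|[dphi]]; elim: l => [|x l IHl] //=.
  move=> dAnd; have [dphi dc] := IHl (derivable_andEr dAnd); split=> // y.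
  by rewrite inE => /predU1P[->|/dc//]; exact: derivable_andEl dAnd.
move=> dc; apply: derivable_andI; first by apply: dc; exact: mem_head.
by apply: IHl => y yl; apply: dc; rewrite inE yl orbT.
Qed.

Section Idempotent.
Hypothesis c_idem : forall x, interderivable (Tens (c x) (c x)) (c x).

Lemma bigTens_absorb x l : x \in l ->
  interderivable (Tens (c x) (bigTens (map c l))) (bigTens (map c l)).
Proof.
elim: l => // y l IHl; rewrite inE map_cons bigTens_cons interderivable_tensA.
case/predU1P=> [<-|/IHl absorb_l]; first by rewrite c_idem.
by rewrite (interderivable_tensC (c x)) -interderivable_tensA absorb_l.
Qed.

Lemma bigTens_absorb_subset l m : {subset m <= l} ->
  interderivable (Tens (bigTens (map c l)) (bigTens (map c m)))
                 (bigTens (map c l)).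
Proof.
elim: m => [|x m IHm] ml; first exact: interderivable_tens_Bot.
rewrite map_cons bigTens_cons (interderivable_tensC (c x)) interderivable_tensA.
rewrite IHm => [|y ym]; last by apply: ml; rewrite inE ym orbT.
by rewrite interderivable_tensC bigTens_absorb // ml // mem_head.
Qed.

Lemma bigTens_eq_mem l m : l =i m ->
  interderivable (bigTens (map c l)) (bigTens (map c m)).
Proof.
move=> lm; rewrite -(@bigTens_absorb_subset l m) => [|x]; last by rewrite lm.
by rewrite interderivable_tensC bigTens_absorb_subset // => x; rewrite lm.
Qed.

End Idempotent.

End IteratedConnectives.

Lemma bigOr_tens_proves (T U : eqType) (c : T -> form) (d : U -> form)
    (chi : form) (l : seq T) (m : seq U) :
  (forall x y, x \in l -> y \in m -> proves (Tens (c x) (d y)) chi) ->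
  proves (Tens (bigOr (map c l)) (bigOr (map d m))) chi.
Proof.
move=> tens_chi; apply: tens_bigOr_proves => y ym.
rewrite interderivable_tensC; apply: tens_bigOr_proves => x xl.
by rewrite interderivable_tensC; exact: tens_chi.
Qed.

(** * Literals *)

Lemma classical_NE_free phi : classical phi -> NE_free phi.
Proof. by elim: phi => //= phi IHphi psi IHpsi /andP[/IHphi-> /IHpsi->]. Qed.

Lemma classical_lit i b : classical (lit i b).
Proof. by case: b. Qed.

Lemma sat_lit (X : team) i b : sat X (lit i b) <-> (forall s, X s -> s i = b).
Proof. by case: b. Qed.

Lemma derivable_lit_cases (alpha : form) (l : seq nat) (G : set form) :
  classical alpha -> classical_ctx G -> uniq l ->
  (forall s : valuation,
     derivable ([set lit i (s i) | i in [set` l]] `|` G) alpha) ->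
  derivable G alpha.
Proof.
move=> alpha_cl; elim: l G => [|i l IHl] G G_cl /=.
  by move=> _ /(_ xpredT); rewrite set_nil image_set0 set0U.
move=> /andP[il l_uniq] all_cases.
have lit_case b : derivable (lit i b |` G) alpha.
  apply: IHl => // [phi [->|/G_cl//]|s]; first exact: classical_lit.
  apply: derivable_weak (all_cases (fun j => if j == i then b else s j)).
  move=> beta [[j /= + <-]|Gbeta]; last by right; right.
  rewrite inE => /predU1P[->|jl]; first by rewrite eqxx; right; left.
  by left; exists j => //; rewrite ifN //; apply: contraNneq il => <-.
apply: (derivable_tensE alpha_cl G_cl (@subset_refl _ G)).
- exact/derivable_axiom/(D_exclmid i).
- exact: (lit_case true).
- exact: (lit_case false).
Qed.

(** * Teams on a finite index set *)

Section FiniteTeams.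
Variable N : {fset nat}.
Implicit Types (f : {ffun N -> bool}) (X Y Z : {set {ffun N -> bool}}).
Implicit Types (G D : set form) (phi psi chi alpha : form).

Definition extend f : valuation :=
  fun i => if insub i is Some j then f j else false.

Lemma extendE f (j : N) : extend f (val j) = f j.
Proof. by rewrite /extend valK. Qed.

Lemma extend_inj : injective extend.
Proof. by move=> f g fg; apply/ffunP => j; rewrite -!extendE fg. Qed.

Definition team_of X : team := [set extend f | f in [set` X]].

Lemma team_ofP X f : team_of X (extend f) <-> f \in X.
Proof. by split=> [[g /= gX /extend_inj <-]|fX] //; exists f. Qed.

Lemma team_of_inj : injective team_of.
Proof.
move=> X Y XY; apply/setP => f.
by apply/idP/idP => /team_ofP; [rewrite XY|rewrite -XY] => /team_ofP.
Qed.

Lemma team_of0 : team_of finset.set0 = set0.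
Proof. by apply/seteqP; split=> // s [f /=]; rewrite finset.inE. Qed.

Lemma team_ofU X Y : team_of (X :|: Y) = team_of X `|` team_of Y.
Proof.
rewrite -image_setU; congr (_ @` _).
by apply/seteqP; split=> f /=; rewrite finset.inE => /orP.
Qed.

Lemma team_of_subset X (T : team) :
  T `<=` team_of X -> exists Y, team_of Y = T.
Proof.
move=> TX; exists [set f in X | `[< T (extend f) >]]%SET.
apply/seteqP; split=> [s [f /=]|s Ts].
  by rewrite finset.inE => /andP[_ /asboolP ?] <-.
have [f /= fX fs] := TX _ Ts; exists f => //=.
by rewrite finset.inE fX; apply/asboolP; rewrite fs.
Qed.

Lemma sat_team_of_Bot X : sat (team_of X) Bot <-> X = finset.set0.
Proof. by split=> [|->] /=; rewrite -team_of0 // => /team_of_inj. Qed.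

Lemma sat_team_of_lit X (j : N) b :
  sat (team_of X) (lit (val j) b) <-> (forall f, f \in X -> f j = b).
Proof.
rewrite sat_lit; split=> [Xb f /team_ofP/Xb|Xb s [f fX <-]]; rewrite extendE //.
exact: Xb.
Qed.

Lemma sat_team_of_tens X phi psi : sat (team_of X) (Tens phi psi) <->
  exists Y Z, [/\ X = Y :|: Z, sat (team_of Y) phi & sat (team_of Z) psi].
Proof.
split=> [[_ [_ [/team_of_subset[Y <-] /team_of_subset[Z <-] XYZ satY satZ]]]|].
  by exists Y, Z; split=> //; apply: team_of_inj; rewrite XYZ team_ofU.
move=> [Y [Z [-> satY satZ]]]; exists (team_of Y), (team_of Z).
by rewrite team_ofU; split.
Qed.

(** * Complete conjunctions of literals *)

Definition conj_lits phi f : form :=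
  foldr And phi [seq lit (val i) (f i) | i : N].

Lemma derivable_conj_litsP G phi f : derivable G (conj_lits phi f) <->
  derivable G phi /\ (forall i : N, derivable G (lit (val i) (f i))).
Proof.
rewrite /conj_lits (derivable_foldr_AndP (fun i : N => lit (val i) (f i))).
by split=> -[dphi dlit]; split=> // i *; apply: dlit; rewrite mem_enum.
Qed.

Lemma classical_conj_lits phi f : classical phi -> classical (conj_lits phi f).
Proof.
rewrite /conj_lits /image_mem => phi_cl.
by elim: (enum _) => //= i l ->; rewrite classical_lit.
Qed.

(* The unit [Top] keeps the conjunction classical also when [N] is empty. *)
Lemma derivable_bigTens_conj_lits G :
  derivable G (bigTens [seq conj_lits Top f | f : {ffun N -> bool}]).
Proof.
apply: (@derivable_weak set0) => //.
apply: (@derivable_lit_cases _ (map val (enum {: N}))) => // [||s].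
- by apply: classical_bigTens => f; exact: classical_conj_lits.
- by rewrite map_inj_uniq ?enum_uniq //; exact: val_inj.
pose f : {ffun N -> bool} := [ffun i => s (val i)].
apply: (@derivable_proves _ (conj_lits Top f)).
  apply: proves_bigTensI => [g|]; last by rewrite mem_enum.
  exact/classical_NE_free/classical_conj_lits.
apply/derivable_conj_litsP; split=> [|i]; first exact: derivable_Top.
apply: derivable_assume; left; exists (val i); last by rewrite ffunE.
by rewrite /= map_f // mem_enum.
Qed.

Lemma conjNE_proves_NE f : proves (conjNE f) NE.
Proof. exact: ((derivable_conj_litsP _ NE f).1 (proves_refl _)).1. Qed.

Lemma conjNE_proves_lit f (i : N) : proves (conjNE f) (lit (val i) (f i)).
Proof. exact: ((derivable_conj_litsP _ NE f).1 (proves_refl _)).2. Qed.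

Lemma conj_lits_proves_conjNE phi f :
  proves (And NE (conj_lits phi f)) (conjNE f).
Proof.
have /derivable_conj_litsP[_ dlit] :=
  derivable_andEr (proves_refl (And NE (conj_lits phi f))).
apply/(derivable_conj_litsP _ NE); split=> //.
exact/derivable_andEl/proves_refl.
Qed.

Lemma conjNE_idem f : interderivable (Tens (conjNE f) (conjNE f)) (conjNE f).
Proof.
split; last exact/derivable_tensdup/proves_refl.
apply/(derivable_conj_litsP _ NE); split=> [|i].
  exact/tens_proves_NE/conjNE_proves_NE.
by apply: tens_proves; first exact: classical_lit; exact: conjNE_proves_lit.
Qed.

(** * The formulas [Theta X] *)

Lemma Theta0 : Theta (finset.set0 : {set {ffun N -> bool}}) = Bot.
Proof. by rewrite /Theta enum_set0. Qed.

Lemma Theta_absorb f X : f \in X ->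
  interderivable (Tens (conjNE f) (Theta X)) (Theta X).
Proof.
by move=> fX; apply: bigTens_absorb conjNE_idem _ _ _; rewrite mem_enum.
Qed.

Lemma ThetaU X Y : interderivable (Theta (X :|: Y)) (Tens (Theta X) (Theta Y)).
Proof.
rewrite -bigTens_cat -map_cat; apply: bigTens_eq_mem conjNE_idem _ _ _ => f.
by rewrite mem_cat !mem_enum finset.inE.
Qed.

Lemma Theta_proves_NE X : X <> finset.set0 -> proves (Theta X) NE.
Proof.
move/eqP/set0Pn => [f fX]; rewrite -(Theta_absorb fX).
exact/tens_proves_NE/conjNE_proves_NE.
Qed.

Lemma derivable_Theta_absurd G D X f : f \in X -> classical_ctx D -> D `<=` G ->
  derivable G (Theta X) -> derivable (conjNE f |` D) Bot -> derivable G BotNE.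
Proof.
move=> fX D_cl DG; rewrite -(Theta_absorb fX) => /derivable_tensC dX dBot.
apply: (derivable_tens_absurd D_cl DG dX); apply: derivable_andI dBot _.
exact/derivable_setU1_proves/conjNE_proves_NE.
Qed.

Lemma derivable_Theta_cases G chi :
  (forall X, derivable (Theta X |` G) chi) -> derivable G chi.
Proof.
move=> all_cases; apply: derivable_Bot_NE_cases; first by rewrite -Theta0.
have := derivable_NE_bigTens (derivable_setU1 G NE)
  (derivable_bigTens_conj_lits (NE |` G)).
move/derivable_bigOrE; apply=> X _; apply: (@derivable_cut _ (Theta X)).
  apply: derivable_setU1_proves; apply: proves_bigTens => f.
  exact: conj_lits_proves_conjNE.
apply: derivable_weak (all_cases X); apply: setUS.
exact: subset_trans (@subsetUr _ _ _) (@subsetUr _ _ _).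
Qed.

Lemma Theta_proves_lit X i b :
  i \in N -> sat (team_of X) (lit i b) -> proves (Theta X) (lit i b).
Proof.
move=> iN /(@sat_team_of_lit X [` iN]%fset) Xb.
apply: bigTens_proves => [||f]; first exact: classical_lit.
  exact/classical_NE_free/classical_lit.
by rewrite mem_enum => /Xb <-; exact: conjNE_proves_lit.
Qed.

Lemma Theta_proves X phi :
  (vars phi `<=` N)%fset -> sat (team_of X) phi -> proves (Theta X) phi.
Proof.
elim: phi X => [i|i|||a IHa b IHb|a IHa b IHb|a IHa b IHb] X;
  rewrite /= ?fsub1set ?fsubUset.
- exact: (@Theta_proves_lit X i true).
- exact: (@Theta_proves_lit X i false).
- by move=> _ /sat_team_of_Bot ->; rewrite Theta0.
- by move=> _ nX; apply: Theta_proves_NE => /sat_team_of_Bot.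
- by move=> /andP[va vb] [/(IHa _ va) ? /(IHb _ vb) ?]; exact: derivable_andI.
- move=> /andP[va vb] /sat_team_of_tens[Y [Z [-> satY satZ]]].
  by rewrite ThetaU; apply: proves_tens; [exact: IHa | exact: IHb].
- move=> /andP[va vb] [/(IHa _ va)|/(IHb _ vb)]; first exact: derivable_orIl.
  exact: derivable_orIr.
Qed.

(** * Normal forms *)

Definition models phi : seq {set {ffun N -> bool}} :=
  [seq X <- enum {set {ffun N -> bool}} | `[< sat (team_of X) phi >]].

Lemma mem_models X phi : X \in models phi <-> sat (team_of X) phi.
Proof. by rewrite mem_filter mem_enum andbT; split=> /asboolP. Qed.

Definition normal_form phi : form := bigOr (map (@Theta N) (models phi)).

Lemma derivable_normal_formI G X phi :
  sat (team_of X) phi -> derivable G (Theta X) ->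
  derivable G (normal_form phi).
Proof.
by move=> /mem_models ?; apply: derivable_proves; exact: proves_bigOrI.
Qed.

Lemma derivable_normal_formE G phi chi : derivable G (normal_form phi) ->
  (forall X, sat (team_of X) phi -> derivable (Theta X |` G) chi) ->
  derivable G chi.
Proof.
move=> dphi all_models; apply: derivable_bigOrE dphi _ => X.
by move=> /mem_models/all_models.
Qed.

Lemma normal_form_mono phi psi :
  entails psi phi -> proves (normal_form psi) (normal_form phi).
Proof.
move=> psi_phi; apply: bigOr_subset_proves => X.
by move=> /mem_models/psi_phi/mem_models.
Qed.

Lemma normal_form_proves phi :
  (vars phi `<=` N)%fset -> proves (normal_form phi) phi.
Proof.
move=> phi_N; apply: derivable_normal_formE (proves_refl _) _ => X satX.
exact/derivable_setU1_proves/Theta_proves.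
Qed.

Lemma proves_normal_form_by_refutation phi :
  (forall X, ~ sat (team_of X) phi ->
     derivable (Theta X |` [set phi]) BotNE) ->
  proves phi (normal_form phi).
Proof.
move=> refute; apply: derivable_Theta_cases => X.
have [satX|nsatX] := EM (sat (team_of X) phi); last first.
  exact/derivable_exfalso/refute.
exact: derivable_normal_formI satX (derivable_setU1 _ _).
Qed.

Lemma proves_normal_form_lit i b :
  i \in N -> proves (lit i b) (normal_form (lit i b)).
Proof.
move=> iN; pose j : N := [` iN]%fset.
apply: proves_normal_form_by_refutation => X.
rewrite (@sat_team_of_lit X j) => /existsNP[f /not_implyP[fX /eqP fj]].
apply: (@derivable_Theta_absurd _ [set lit i b] X f) => //.
- by move=> _ ->; exact: classical_lit.
- exact: derivable_setU1.
- apply: (derivable_lit_contra fj); last exact/derivable_weakU1/proves_refl.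
  exact: derivable_setU1_proves (conjNE_proves_lit f j).
Qed.

Lemma proves_normal_form_Bot : proves Bot (normal_form Bot).
Proof.
apply: proves_normal_form_by_refutation => X.
rewrite sat_team_of_Bot => /eqP/set0Pn[f fX].
apply: (@derivable_Theta_absurd _ [set Bot] X f) => //.
- by move=> _ ->.
- exact: derivable_setU1.
- exact/derivable_weakU1/proves_refl.
Qed.

Lemma proves_normal_form_NE : proves NE (normal_form NE).
Proof.
apply: proves_normal_form_by_refutation => X /contrapT/sat_team_of_Bot ->.
rewrite Theta0; apply: derivable_andI; first exact: derivable_setU1.
exact/derivable_weakU1/proves_refl.
Qed.

Lemma proves_normal_form_And phi psi :
  proves phi (normal_form phi) -> proves psi (normal_form psi) ->
  proves (And phi psi) (normal_form (And phi psi)).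
Proof.
move=> nf_phi nf_psi.
have := derivable_proves nf_phi (derivable_andEl (proves_refl (And phi psi))).
move/derivable_normal_formE; apply=> X satX.
have := derivable_proves nf_psi (derivable_andEr (proves_refl (And phi psi))).
move/(@derivable_weakU1 _ (Theta X))/derivable_normal_formE; apply=> Y satY.
have dX : derivable (Theta Y |` (Theta X |` [set And phi psi])) (Theta X).
  exact/derivable_weakU1/derivable_setU1.
have [XY|/eqP XY] := eqVneq X Y.
  by apply: derivable_normal_formI dX; split=> //; rewrite XY.
exact/derivable_exfalso/(derivable_Theta_contra XY dX)/derivable_setU1.
Qed.

Lemma proves_normal_form_Tens phi psi :
  proves phi (normal_form phi) -> proves psi (normal_form psi) ->
  proves (Tens phi psi) (normal_form (Tens phi psi)).
Proof.
move=> nf_phi nf_psi; apply: proves_trans (proves_tens nf_phi nf_psi) _.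
apply: bigOr_tens_proves => X Y /mem_models satX /mem_models satY.
rewrite -ThetaU; apply: derivable_normal_formI (proves_refl _).
by apply/sat_team_of_tens; exists X, Y.
Qed.

Lemma proves_normal_form_Or phi psi :
  proves phi (normal_form phi) -> proves psi (normal_form psi) ->
  proves (Or phi psi) (normal_form (Or phi psi)).
Proof.
move=> nf_phi nf_psi; apply: derivable_orE (proves_refl (Or phi psi)) _ _.
  apply/derivable_setU1_proves/(proves_trans nf_phi).
  by apply: normal_form_mono => X; left.
apply/derivable_setU1_proves/(proves_trans nf_psi).
by apply: normal_form_mono => X; right.
Qed.

Lemma proves_normal_form phi :
  (vars phi `<=` N)%fset -> proves phi (normal_form phi).
Proof.
elim: phi => [i|i|||a IHa b IHb|a IHa b IHb|a IHa b IHb];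
  rewrite /= ?fsub1set ?fsubUset.
- exact: (@proves_normal_form_lit i true).
- exact: (@proves_normal_form_lit i false).
- by move=> _; exact: proves_normal_form_Bot.
- by move=> _; exact: proves_normal_form_NE.
- by move=> /andP[/IHa ? /IHb ?]; exact: proves_normal_form_And.
- by move=> /andP[/IHa ? /IHb ?]; exact: proves_normal_form_Tens.
- by move=> /andP[/IHa ? /IHb ?]; exact: proves_normal_form_Or.
Qed.

Lemma interderivable_normal_form phi :
  (vars phi `<=` N)%fset -> interderivable phi (normal_form phi).
Proof.
by move=> ?; split; [exact: proves_normal_form|exact: normal_form_proves].
Qed.

End FiniteTeams.

Lemma entails_proves phi psi : entails psi phi -> proves psi phi.
Proof.
move=> psi_phi; pose N := (vars psi `|` vars phi)%fset.
rewrite (@interderivable_normal_form N psi) ?fsubsetUl //.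
rewrite (@interderivable_normal_form N phi) ?fsubsetUr //.
exact: normal_form_mono.
Qed.

Theorem theorem5p6 (phi psi : form) :
  (entails psi phi -> derivable [set psi] phi) /\
  (valid phi -> derivable set0 phi).
Proof.
split=> [|phi_valid]; first exact: entails_proves.
apply: derivable_proves (derivable_Top set0).
by apply: entails_proves => X _; exact: phi_valid.
Qed.
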